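(* Let $N$ be a positive integer with $2N\geq 3\times 10^{6}$. Then $\operatorname{card}X_{2N}>\operatorname{card}P_{2N}$.
   Context: For a positive integer $N$, a prime of type P related to $2N$ is a prime $p$ with $p<2N-2$ and $p\nmid 2N$. $P_{2N}$ denotes the set of primes of type P related to $2N$. A composite of type P related to $2N$ is a composite integer $x<2N-2$ all of whose prime factors are primes of type P related to $2N$ (equivalently, a composite $x<2N-2$ with $\gcd(x,2N)=1$). $X_{2N}$ denotes the set of composites of type P related to $2N$. *)

(* Defs.v *)
From mathcomp Require Import all_boot.

Definition P_set (N : nat) : {set 'I_(N.*2 - 2)} :=
  [set x : 'I_(N.*2 - 2) | prime x && ~~ (x %| N.*2)].

Definition composite (x : nat) : bool := (1 < x) && ~~ prime x.

Definition X_set (N : nat) : {set 'I_(N.*2 - 2)} :=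
  [set x : 'I_(N.*2 - 2) | composite x &&
     all (fun p => (p < N.*2 - 2) && ~~ (p %| N.*2)) (primes x)].

(* Main.v *)
(* Write n = 2N. Among the totatives of n at most two, 1 and n - 1, are neither
   in P nor in X, and P misses the prime 2, so it suffices that
   2 pi(n) < phi(n). Chebyshev's integer quotient
   (30m)! m! / ((15m)! (10m)! (6m)!) is at most (2^14 3^9 5^5)^m and is divisible
   by every prime in (5m, 30m]; iterating over m = x/30, x/180, ... gives
   pi(x) (log2 x - 3.6) <= 1.605 x. On the other side, if n has 7 + j prime
   divisors then phi(n)/n >= (18 / (18 + j)) prod_{p <= 17} (1 - 1/p), while
   n >= 510510 * 19^j, so phi(n)/n decays more slowly than 1 / log n. *)

From Stdlib Require Import ZArith Reals Lra Lia.
Require Import Defs.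
From mathcomp Require Import all_boot zify.

(** * Evaluating the large numeral digit by digit *)

Lemma of_uint_acc_D0 d acc :
  Nat.of_uint_acc (Decimal.D0 d) acc = Nat.of_uint_acc d (10 * acc).
Proof. exact: (congr1 (Nat.of_uint_acc d) (Nat.tail_mul_spec 10 acc)). Qed.

(* Literals above 5000 are kept as [Nat.of_num_uint] applications, which [lia]
   does not see through; hence also [561 * 10] for 5610 below. *)
Lemma three_millionE : 3000000 = 3 * 10 ^ 6.
Proof.
have D3E d : Nat.of_num_uint (Number.UIntDecimal (Decimal.D3 d)) =
    Nat.of_uint_acc d 3 by [].
have NilE acc : Nat.of_uint_acc Decimal.Nil acc = acc by [].
by rewrite D3E !of_uint_acc_D0 NilE [RHS]mulnC !expnS expn0 muln1 -!mulnA.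
Qed.

(** * Chebyshev's integer factorial quotient *)

(** Legendre's formula, padded with vanishing terms so that the sums for several factorials share
    one range and can be merged termwise. *)
Lemma logn_fact_widen p n m : prime p -> n <= m ->
  logn p n`! = \sum_(1 <= k < m.+1) n %/ p ^ k.
Proof.
move=> p_pr le_nm; rewrite logn_fact // (big_cat_nat (n := n.+1) (p := m.+1)) //=.
rewrite [X in _ = _ + X]big_nat_cond [X in _ = _ + X]big1 ?addn0 // => k.
rewrite andbT => /andP[lt_nk _]; apply: divn_small.
by apply: ltn_trans lt_nk _; apply: ltn_expl; apply: prime_gt1.
Qed.

(** All floors are functions of [t = (30 * n) %/ q], and [t %/ 2 + t %/ 3 + t %/ 5 <= t + t %/ 30].
    The bracket forces [1 <= t <= 5], where this inequality has slack exactly 1. *)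
Lemma leq_chebyshev_floor n q : 0 < q ->
  (15 * n) %/ q + (10 * n) %/ q + (6 * n) %/ q + ((5 * n < q) && (q <= 30 * n))
  <= (30 * n) %/ q + n %/ q.
Proof.
move=> q_gt0; set t := (30 * n) %/ q.
have d c e : c * e = 30 -> 0 < e -> (c * n) %/ q = t %/ e.
  by move=> ce e_gt0; rewrite /t -ce -divnMA mulnAC divnMr.
have := d 1 30 erefl isT; rewrite mul1n => ->.
rewrite (d 15 2) // (d 10 3) // (d 6 5) //.
have [/andP[lt_q le_q]|_] := boolP ((5 * n < q) && _); last by lia.
have : 1 <= t by rewrite divn_gt0.
have : t < 6 by rewrite ltn_divLR //; lia.
lia.
Qed.

Lemma logn_prod_primes p a b : prime p ->
  logn p (\prod_(a <= q < b | prime q) q) = (a <= p < b).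
Proof.
move=> p_pr; elim: b => [|b IHb]; first by rewrite big_geq // ltn0 andbF logn1.
have [le_ab|lt_ba] := leqP a b; last first.
  by rewrite big_geq // logn1; case: (leqP a p) => //= le_ap; lia.
rewrite big_mkcond big_nat_recr //= -big_mkcond lognM; first last.
- by case: ifP => // /prime_gt0.
- by rewrite prodn_cond_gt0 // => q /prime_gt0.
rewrite IHb; case: ifP => [b_pr|b_npr]; first by rewrite logn_prime //; lia.
have : p != b by apply: contraTneq p_pr => ->; rewrite b_npr.
rewrite logn1; lia.
Qed.

Lemma chebyshev_dvd n :
  (\prod_((5 * n).+1 <= p < (30 * n).+1 | prime p) p)
    * ((15 * n)`! * (10 * n)`! * (6 * n)`!) %| (30 * n)`! * n`!.
Proof.
set D := \prod_(_ <= p < _ | _) p.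
have D_gt0 : 0 < D by apply: prodn_cond_gt0 => q /prime_gt0.
have A_gt0 : 0 < (15 * n)`! * (10 * n)`! * (6 * n)`! by rewrite !muln_gt0 !fact_gt0.
have B_gt0 : 0 < (30 * n)`! * n`! by rewrite muln_gt0 !fact_gt0.
apply/dvdn_partP=> [|p]; first by rewrite muln_gt0 D_gt0.
rewrite mem_primes => /andP[p_pr _]; rewrite p_part pfactor_dvdn //.
rewrite !lognM ?muln_gt0 ?fact_gt0 // logn_prod_primes //.
rewrite !(@logn_fact_widen p _ (30 * n)) //; try lia.
(* The single factor [p] from the product of primes is charged to the term [k = 1] of the Legendre
   sums. *)
rewrite -!big_split /= (_ : nat_of_bool _ =
  \sum_(1 <= k < (30 * n).+1) ((k == 1) && ((5 * n).+1 <= p < (30 * n).+1))).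
  rewrite -big_split /=; apply: leq_sum => k _.
  have pk_gt0 : 0 < p ^ k by rewrite expn_gt0 prime_gt0.
  rewrite addnC; apply: leq_trans (leq_chebyshev_floor n _ pk_gt0).
  by rewrite leq_add2l; case: eqVneq => [->|_] //=; rewrite expn1 ltnS.
case: (posnP n) => [->|n_gt0]; first by rewrite big_geq //; lia.
rewrite big_ltn /=; last by lia.
rewrite big_nat_cond big1 ?addn0 // => k.
by rewrite andbT; case: k => [|[|k]].
Qed.

Lemma fact_mulnS c n : (c * n.+1)`! = (c * n)`! * \prod_(1 <= i < c.+1) (c * n + i).
Proof.
rewrite mulnS addnC; elim: {2 4}c => [|d IHd]; first by rewrite big_geq // addn0 muln1.
by rewrite big_nat_recr //= mulnA -IHd addnS factS mulnC.
Qed.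


Lemma prod_scale m c d n (s : seq nat) : c * d = m ->
  \prod_(j <- [seq c * i | i <- s]) (m * n + j) =
  c ^ size s * \prod_(i <- s) (d * n + i).
Proof.
move=> <-; rewrite big_map; elim: s => [|i s IHs]; first by rewrite !big_nil.
by rewrite !big_cons IHs /= expnS; lia.
Qed.

(* Scaled by 30, the quotient of consecutive terms of
   (30n)! n! / ((15n)! (10n)! (6n)!) is a ratio of products of linear factors
   [30n + i]; after cancellation the residues [i] coprime to 30 are left above,
   and they are matched in order with larger residues below. *)
Lemma fact_chebyshev_le n :
  (30 * n)`! * n`! <= (2 ^ 14 * 3 ^ 9 * 5 ^ 5) ^ n *
    ((15 * n)`! * (10 * n)`! * (6 * n)`!).
Proof.
(* [K] is opaque, so the huge constant is never expanded in unary. *)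
have [K KE] : {K | K = 2 ^ 14 * 3 ^ 9 * 5 ^ 5} by eexists.
rewrite -KE; elim: n => [|n IHn]; first by rewrite !muln0 fact0.
pose P c (s : seq nat) := \prod_(i <- s) (c * n + i).
have factP c : (c * n.+1)`! = (c * n)`! * P c (iota 1 c).
  by rewrite fact_mulnS /P /index_iota subn1.
(* The factor [n.+1] from [n.+1]! becomes a second residue 30, since [30 * n.+1 = 30 * n + 30]. *)
have P30 : 30 * (P 30 (iota 1 30) * n.+1) = P 30 (rcons (iota 1 30) 30).
  by rewrite /P -cats1 big_cat big_seq1 /= mulnCA mulnS [(30 + _)%N]addnC.
have KP : 30 * (K * (P 15 (iota 1 15) * P 10 (iota 1 10) * P 6 (iota 1 6))) =
    P 30 ([seq 2 * i | i <- iota 1 15] ++ [seq 3 * i | i <- iota 1 10] ++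
          [seq 5 * i | i <- iota 1 6]).
  rewrite [in RHS]/P 2!big_cat (@prod_scale 30 2 15) // (@prod_scale 30 3 10) //.
  rewrite (@prod_scale 30 5 6) // -/(P 15 _) -/(P 10 _) -/(P 6 _) !size_iota.
  move: (P 15 _) (P 10 _) (P 6 _) => x y z.
  by rewrite [RHS]/(2 ^ 15 * x * (3 ^ 10 * y * (5 ^ 6 * z))) KE; lia.
have step : P 30 (iota 1 30) * n.+1 <=
    K * (P 15 (iota 1 15) * P 10 (iota 1 10) * P 6 (iota 1 6)).
  rewrite -(@leq_pmul2l 30) // P30 KP.
  (* The multiples of 2, 3 and 5 up to 30 cover the residues not coprime to 30, some repeatedly.
     Beyond [c], which holds 30 twice, eight repetitions remain: 6, 10, 12, 15, 18, 20, 24, 30. *)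
  pose c := rcons [seq i <- iota 1 30 | ~~ coprime 30 i] 30.
  have -> : P 30 (rcons (iota 1 30) 30) = P 30 (c ++ [:: 1; 7; 11; 13; 17; 19; 23; 29]).
    by apply: perm_big.
  rewrite [leqRHS](_ : _ = P 30 (c ++ [:: 6; 10; 12; 15; 18; 20; 24; 30])); last first.
    by apply: perm_big.
  rewrite /P !big_cat /= leq_mul2l; apply/orP; right.
  by rewrite !big_cons !big_nil !leq_mul ?leq_add2l.
rewrite (factP 30) (factP 15) (factP 10) (factP 6) factS expnS.
rewrite [n.+1 * _]mulnC mulnACA; apply: leq_trans (leq_mul IHn step) _.
move: (K ^ n) (P 15 _) (P 10 _) (P 6 _) (15 * n)`! (10 * n)`! (6 * n)`!; clear.
by move=> Kn x y z a b c; apply: eq_leq; lia.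
Qed.

(** * Counting primes between [5n] and [30n] *)

Definition prime_count n := \sum_(0 <= p < n.+1 | prime p) 1.

Lemma prime_count_cat m n : m <= n ->
  prime_count n = prime_count m + \sum_(m.+1 <= p < n.+1 | prime p) 1.
Proof. by move=> le_mn; rewrite /prime_count (big_cat_nat (n := m.+1)). Qed.

Lemma leq_prime_count m n : m <= n -> prime_count m <= prime_count n.
Proof. by move=> /prime_count_cat ->; apply: leq_addr. Qed.

Lemma prime_countS n : prime_count n.+1 = prime_count n + prime n.+1.
Proof.
by rewrite (prime_count_cat n) // big_mkcond big_nat1; case: ifP.
Qed.

Lemma prod_primes_5n_30n_le n :
  \prod_((5 * n).+1 <= p < (30 * n).+1 | prime p) p <= (2 ^ 14 * 3 ^ 9 * 5 ^ 5) ^ n.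
Proof.
have F_gt0 : 0 < (15 * n)`! * (10 * n)`! * (6 * n)`! by rewrite !muln_gt0 !fact_gt0.
rewrite -(leq_pmul2r F_gt0); apply: leq_trans (fact_chebyshev_le n).
by apply: dvdn_leq (chebyshev_dvd n); rewrite muln_gt0 !fact_gt0.
Qed.

Lemma expn_prime_count_le n :
  (5 * n) ^ (prime_count (30 * n) - prime_count (5 * n))
  <= (2 ^ 14 * 3 ^ 9 * 5 ^ 5) ^ n.
Proof.
apply: leq_trans (prod_primes_5n_30n_le n).
rewrite (prime_count_cat (5 * n) (30 * n)) ?leq_mul2r ?orbT // addKn expn_sum.
rewrite big_nat_cond [leqRHS]big_nat_cond; apply: leq_prod => p.
by rewrite expn1 => /andP[/andP[/ltnW]].
Qed.

(** * Binary logarithms and their rational bounds *)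

Local Open Scope R_scope.

Definition log2 (x : R) : R := ln x / ln 2.

Lemma log2_le x y : 0 < x -> x <= y -> log2 x <= log2 y.
Proof.
move=> x_gt0 le_xy; apply: Rmult_le_compat_r.
  by apply/Rlt_le/Rinv_0_lt_compat; rewrite -ln_1; apply: ln_increasing; lra.
by case: le_xy => [/ln_increasing|->]; [move=> /(_ x_gt0)|]; lra.
Qed.

Lemma log2_mult x y : 0 < x -> 0 < y -> log2 (x * y) = log2 x + log2 y.
Proof. by move=> x_gt0 y_gt0; rewrite /log2 ln_mult //; field; have := ln_lt_2; lra. Qed.

Lemma log2_pow x n : 0 < x -> log2 (x ^ n) = INR n * log2 x.
Proof. by move=> x_gt0; rewrite /log2 ln_pow //; field; have := ln_lt_2; lra. Qed.

Lemma log2_2 : log2 2 = 1.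
Proof. by rewrite /log2; field; have := ln_lt_2; lra. Qed.

Lemma INR_expn m n : INR (expn m n) = INR m ^ n.
Proof. by elim: n => // n IHn; rewrite expnS mult_INR IHn. Qed.

Lemma log2_expZ a b : (0 < a)%Z -> (0 <= b)%Z ->
  log2 (IZR (a ^ b)) = IZR b * log2 (IZR a).
Proof.
move=> a_gt0 b_ge0; rewrite -{1}(Z2Nat.id b) // -pow_IZR log2_pow ?INR_IZR_INZ ?Z2Nat.id //.
exact: IZR_lt.
Qed.

(** Reduces the rational bound [k / b] on [log2 a] to a comparison of integer powers, which
    computation decides. *)
Lemma log2_leZ a b k : (0 < a)%Z -> (0 <= b)%Z -> (0 <= k)%Z -> (a ^ b <= 2 ^ k)%Z ->
  IZR b * log2 (IZR a) <= IZR k.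
Proof.
move=> a_gt0 b_ge0 k_ge0 le_ab.
rewrite -log2_expZ // -[IZR k]Rmult_1_r -log2_2 -log2_expZ //.
by apply: log2_le; [apply/IZR_lt/Z.pow_pos_nonneg | apply: IZR_le].
Qed.

Lemma log2_geZ a b k : (0 < a)%Z -> (0 <= b)%Z -> (0 <= k)%Z -> (2 ^ k <= a ^ b)%Z ->
  IZR k <= IZR b * log2 (IZR a).
Proof.
move=> a_gt0 b_ge0 k_ge0 le_ab.
rewrite -log2_expZ // -[IZR k]Rmult_1_r -log2_2 -log2_expZ //.
by apply: log2_le; [apply/IZR_lt/Z.pow_pos_nonneg | apply: IZR_le].
Qed.

(** 485/306, like 137/59 for [log2 5], is a continued fraction convergent from above. *)
Lemma log2_3_le : log2 3 <= 485 / 306.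
Proof. by have := @log2_leZ 3 306 485 ltac:(lia) ltac:(lia) ltac:(lia) ltac:(by vm_compute); lra. Qed.

Lemma log2_5_le : log2 5 <= 137 / 59.
Proof. by have := @log2_leZ 5 59 137 ltac:(lia) ltac:(lia) ltac:(lia) ltac:(by vm_compute); lra. Qed.

(** The constant rounds up [14 + 9 * (485 / 306) + 5 * (137 / 59)]. *)
Lemma prime_count_log2_le n : (0 < n)%N ->
  INR (prime_count (30 * n) - prime_count (5 * n)) * log2 (INR (5 * n))
  <= 39.875 * INR n.
Proof.
move=> n_gt0; have /leP/le_INR := expn_prime_count_le n.
have KE : INR (expn 2 14 * expn 3 9 * expn 5 5) = 2 ^ 14 * 3 ^ 9 * 5 ^ 5.
  rewrite 2!mult_INR !INR_expn.
  by rewrite (INR_IZR_INZ 2) (INR_IZR_INZ 3) (INR_IZR_INZ 5).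
have y_gt0 : 0 < INR (5 * n) by apply/lt_0_INR/ltP; rewrite muln_gt0.
set d := (_ - _)%N; rewrite !INR_expn KE => /log2_le.
rewrite !log2_pow //; last by apply: Rmult_lt_0_compat; [apply: Rmult_lt_0_compat|]; apply: pow_lt; lra.
move/(_ (pow_lt _ _ y_gt0)).
have -> : log2 (2 ^ 14 * 3 ^ 9 * 5 ^ 5) = 14 + 9 * log2 3 + 5 * log2 5.
  rewrite 2?log2_mult ?log2_pow ?log2_2 ?(INR_IZR_INZ 14) ?(INR_IZR_INZ 9) ?(INR_IZR_INZ 5) /=; lra.
have := log2_3_le; have := log2_5_le; have := pos_INR n; nra.
Qed.

Local Close Scope R_scope.

(** * Verified computation for [x] up to 5610 *)

(** Trial division only by primes up to 31: a survivor may be composite, which can only enlarge the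
    resulting count. *)
Definition sieved (x : Z) : bool :=
  has (fun d => (x mod d =? 0)%Z && ~~ (x =? d)%Z)
    [:: 2; 3; 5; 7; 11; 13; 17; 19; 23; 29; 31]%Z.

(* With [log2_up (x ^ 4) / 4] as an upper bound of [log2 x], this tests
   [c * (log2 x - 3.6) <= 1.605 * x], scaled by 200. *)
Definition small_count (x c : Z) : bool :=
  (c * (50 * Z.log2_up (x ^ 4) - 720) <=? 321 * x)%Z.

(* [c] bounds the number of primes below [x]. *)
Fixpoint prime_count_check (fuel : nat) (x c : Z) : bool :=
  if fuel is fuel'.+1 then
    let c' := if sieved x then c else (c + 1)%Z in
    small_count x c' && prime_count_check fuel' (x + 1) c'
  else true.

Lemma sieved_nprime n : sieved (Z.of_nat n) -> ~~ prime n.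
Proof.
have small d : (1 < d)%Z -> (Z.of_nat n mod d =? 0)%Z && ~~ (Z.of_nat n =? d)%Z -> ~~ prime n.
  move=> d_gt1 /andP[/Z.eqb_eq mod_d /negPf/Z.eqb_neq neq_d].
  have [q nE] : (d | Z.of_nat n)%Z by apply/Z.mod_divide; lia.
  apply: contra_notN neq_d => /primeP[_ /(_ (Z.to_nat d))].
  have -> : (Z.to_nat d %| n)%N.
    by apply/dvdnP; exists (Z.to_nat q); nia.
  by move/(_ isT)/orP=> [] /eqP; lia.
rewrite /sieved /=.
by do ![case/orP; first exact: small].
Qed.

Lemma prime_count_checkP fuel x c : (0 < x)%N ->
  (Z.of_nat (prime_count x.-1) <= c)%Z -> prime_count_check fuel (Z.of_nat x) c ->
  forall y, (x <= y < x + fuel)%N -> exists2 k : Z, (Z.of_nat y ^ 4 <= 2 ^ k)%Z &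
    (0 <= k)%Z /\ (Z.of_nat (prime_count y) * (50 * k - 720) <= 321 * Z.of_nat y)%Z.
Proof.
elim: fuel x c => [|f IHf] x c x_gt0 le_c; first by move=> _ y; rewrite addn0; lia.
rewrite [prime_count_check _ _ _]/=; set c' := if _ then _ else _.
move=> /andP[/Z.leb_le le_x chk] y.
have le_c' : (Z.of_nat (prime_count x) <= c')%Z.
  have := prime_countS x.-1; rewrite (prednK x_gt0) /c' => ->.
  have := sieved_nprime x; case: (sieved _) => [/(_ isT)/negPf->|_]; first by rewrite addn0.
  by case: (prime x); lia.
rewrite leq_eqVlt => /andP[/orP[/eqP<-|lt_xy] lt_y]; last first.
  by apply: (IHf x.+1 c') => //; [rewrite Nat2Z.inj_succ|lia].
exists (Z.log2_up (Z.of_nat x ^ 4)).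
  by apply: proj2 (Z.log2_log2_up_spec _ _); apply: Z.pow_pos_nonneg; lia.
split; first exact: Z.log2_up_nonneg.
(* If the coefficient is nonnegative, [c'] bounds the count and the check applies; if it is
   negative, the left side is at most 0. *)
case: (Z.le_gt_cases 0 (50 * Z.log2_up (Z.of_nat x ^ 4) - 720)); nia.
Qed.

Local Open Scope R_scope.

Lemma prime_count_small x : (0 < x <= 561 * 10)%N ->
  INR (prime_count x) * (log2 (INR x) - 3.6) <= 1.605 * INR x.
Proof.
move=> /andP[x_gt0 le_x].
have chk : prime_count_check (561 * 10) 1 0 by vm_compute.
have le_c : (Z.of_nat (prime_count 0) <= 0)%Z.
  by rewrite /prime_count big_mkcond big_nat1.
have [|k le_k [k_ge0]] := @prime_count_checkP (561 * 10) 1 0 isT le_c chk x; first by lia.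
have := @log2_leZ (Z.of_nat x) 4 k ltac:(lia) ltac:(lia) k_ge0 le_k.
move=> le_log /IZR_le; rewrite !mult_IZR minus_IZR mult_IZR -!INR_IZR_INZ.
move: le_log; rewrite -INR_IZR_INZ; have := pos_INR (prime_count x); nra.
Qed.

(** * Explicit upper bound on the number of primes *)

Lemma prime_count_bound x : (0 < x)%N ->
  INR (prime_count x) * (log2 (INR x) - 3.6) <= 1.605 * INR x.
Proof.
elim/ltn_ind: x => x IHx x_gt0.
have [le_x|gt_x] := leqP x (561 * 10); first by apply: prime_count_small; rewrite x_gt0.
pose n := ((x + 29) %/ 30)%N.
(* The final estimate is [47.9 * n <= 1.605 * (30 * n - 29)], that is [0.25 * n >= 46.545], which
   holds from 187 on; hence the cutoff 5610 = 30 * 187. *)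
have [n_ge le_xn le_nx] : [/\ 187 <= n, x <= 30 * n & 30 * n <= x + 29]%N.
  by split; rewrite /n; lia.
have := IHx (5 * n)%N ltac:(lia) ltac:(lia).
have := @prime_count_log2_le n ltac:(lia).
have le_pi := leq_prime_count _ _ (leq_mul (isT : 5 <= 30)%N (leqnn n)).
have := le_INR _ _ (elimT leP (leq_prime_count _ _ le_xn)).
rewrite -{1}(subnK le_pi) plus_INR.
set d := INR (_ - _); set p := INR (prime_count (5 * n)); set t := log2 (INR (5 * n)).
set q := INR (prime_count x).
have y_gt0 : 0 < INR (5 * n) by apply: lt_0_INR; lia.
(* 2.585 exceeds [log2 6]. Below, 1.015 = 3.6 - 2.585. *)
have log_x : log2 (INR x) <= t + 2.585.
  apply: Rle_trans (_ : log2 (2 * 3 * INR (5 * n)) <= _).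
    apply: log2_le; first by apply: lt_0_INR; lia.
    have -> : 2 * 3 = INR 6 by rewrite INR_IZR_INZ -mult_IZR.
    by rewrite -mult_INR; apply: le_INR; lia.
  rewrite !log2_mult ?log2_2 -/t; [have := log2_3_le; lra|lra..].
have t_ge : 8 <= t.
  have -> : 8 = log2 (2 ^ 8) by rewrite log2_pow ?log2_2 /=; lra.
  apply: log2_le; first by lra.
  by rewrite (INR_IZR_INZ (5 * n)) pow_IZR; apply: IZR_le; lia.
have n_geR : 187 <= INR n by rewrite INR_IZR_INZ; apply: IZR_le; lia.
have nx : 30 * INR n <= INR x + 29 by rewrite !INR_IZR_INZ -mult_IZR -plus_IZR; apply: IZR_le; lia.
rewrite mult_INR [INR 5]/=.
have d_ge0 : 0 <= d by apply: pos_INR.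
have p_ge0 : 0 <= p by apply: pos_INR.
have q_ge0 : 0 <= q by apply: pos_INR.
move: (INR n) (INR x) (log2 (INR x)) n_geR nx log_x => m X l m_ge mx l_le q_le dt pt.
have u_gt0 : 0 < / t by apply: Rinv_0_lt_compat; lra.
have v_gt0 : 0 < / (t - 3.6) by apply: Rinv_0_lt_compat; lra.
have tu : t * / t = 1 by field; lra.
have tv : (t - 3.6) * / (t - 3.6) = 1 by field; lra.
move: (/ t) (/ (t - 3.6)) u_gt0 v_gt0 tu tv => u v u_gt0 v_gt0 tu tv.
(* Here 20.744625 = 8.025 * 2.585 and 40.473125 = 39.875 * 1.015 are the coefficients of the
   lower-order terms in [(d + p) * (t - 1.015)]; what remains is [(39.875 + 8.025) * m]. *)
have vu : 20.744625 * v <= 40.473125 * u.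
  suff : 0 <= (40.473125 * (t - 3.6) - 20.744625 * t) * (u * v) by nra.
  by apply: Rmult_le_pos; [lra | apply/Rlt_le/Rmult_lt_0_compat].
have d_le : d * (t - 1.015) <= 39.875 * m * (1 - 1.015 * u).
  have -> : d * (t - 1.015) = d * t * (1 - 1.015 * u).
    by have -> : d * t * (1 - 1.015 * u) = d * t - 1.015 * d * (t * u); [ring|rewrite tu; ring].
  by apply: Rmult_le_compat_r => //; nra.
have p_le : p <= 8.025 * m * v.
  have -> : p = p * (t - 3.6) * v by rewrite Rmult_assoc tv; ring.
  by apply: Rmult_le_compat_r; lra.
have q_le' : q * (l - 3.6) <= (d + p) * (t - 1.015) by nra.
nra.
Qed.

Local Close Scope R_scope.

(** * Bounding [totient n] and [n] by the number of prime divisors *)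

Lemma sorted_all_gt m p s : m <= p -> sorted ltn (p :: s) -> all (leq m.+1) s.
Proof.
move=> le_mp /(order_path_min ltn_trans); apply: sub_all => q; exact: leq_ltn_trans.
Qed.

(** The i-th entry, from [i = 1], is at least [m + i], so the product of [p / (p - 1)] is at most
    that of [(m + i) / (m + i - 1)], which telescopes to [(m + size s) / m]. *)
Lemma prod_pred_ge m s : sorted ltn s -> all (leq m.+1) s ->
  m * \prod_(p <- s) p <= (m + size s) * \prod_(p <- s) p.-1.
Proof.
elim: s m => [|p s IHs] m srt; first by rewrite !big_nil addn0.
move=> /andP[lt_mp _]; rewrite !big_cons.
have := IHs m.+1 (path_sorted srt) (sorted_all_gt _ _ _ lt_mp srt).
move: (\prod_(p <- s) p) (\prod_(p <- s) p.-1) => a b /= le_ab.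
have le_p : m * p <= m.+1 * p.-1 by nia.
rewrite -(leq_pmul2l (ltn0Sn m)); have := leq_mul le_ab le_p.
nia.
Qed.

(** Pairs the entries of [s] in order with the primes in [[m, M)], each entry being at least its
    partner; the surplus entries are at least [M] and telescope by [prod_pred_ge]. *)
Lemma prod_pred_ge_primes m M s : 0 < m <= M ->
  sorted ltn s -> all prime s -> all (leq m) s ->
  M.-1 * (\prod_(p <- s) p * \prod_(m <= q < M | prime q) q.-1) <=
  (M.-1 + (size s - \sum_(m <= q < M | prime q) 1)) *
    (\prod_(p <- s) p.-1 * \prod_(m <= q < M | prime q) q).
Proof.
have [d] := ubnP (M - m); elim: d m s => // d IHd m s le_d /andP[m_gt0 le_mM] srt prs ge_m.
have [eq_mM|lt_mM] : m = M \/ m < M by lia.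
  rewrite eq_mM !big_geq // subn0 !muln1; apply: prod_pred_ge => //.
  by rewrite -eq_mM prednK.
have lt_d : M - m.+1 < d by lia.
case: (boolP (prime m)) => [m_pr|m_npr]; last first.
  rewrite !(big_ltn_cond lt_mM) (negPf m_npr); apply: IHd => //.
  apply/allP => p p_s; rewrite ltn_neqAle (allP ge_m) // andbT.
  by apply: contraNneq m_npr => ->; apply: (allP prs).
rewrite !(big_ltn_cond lt_mM) m_pr.
case: s srt prs ge_m => [|p s] srt prs ge_m.
  (* When [s] runs out, the truncated difference is 0 and the unpaired primes contribute only
     [q.-1 <= q]. *)
  rewrite !big_nil addn0 !mul1n leq_mul2l leq_mul ?orbT ?leq_pred //.
  by apply: leq_prod => q _; apply: leq_pred.
move: prs ge_m => /andP[_ prs] /andP[le_mp _].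
have := IHd m.+1 s lt_d lt_mM (path_sorted srt) prs (sorted_all_gt _ _ _ le_mp srt).
rewrite !big_cons /= add1n subSS.
have le_p : p * m.-1 <= p.-1 * m by nia.
move: (\prod_(p <- s) p) (\prod_(p <- s) p.-1) (\prod_(m.+1 <= q < M | prime q) q.-1)
  (\prod_(m.+1 <= q < M | prime q) q) (size s - _) => a b x y k le_ab.
by have := leq_mul le_ab le_p; lia.
Qed.

(** The same pairing, with each surplus entry bounded below by [M]. *)
Lemma prod_ge_primes m M s : m <= M ->
  sorted ltn s -> all prime s -> all (leq m) s ->
  \sum_(m <= q < M | prime q) 1 <= size s ->
  \prod_(m <= q < M | prime q) q * M ^ (size s - \sum_(m <= q < M | prime q) 1)
  <= \prod_(p <- s) p.
Proof.
have [d] := ubnP (M - m); elim: d m s => // d IHd m s le_d le_mM srt prs ge_m.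
have [eq_mM|lt_mM] : m = M \/ m < M by lia.
  rewrite eq_mM !big_geq // subn0 mul1n => _; move: ge_m; rewrite eq_mM; clear.
  elim: s => [|p s IHs] /=; first by rewrite big_nil.
  by move=> /andP[le_p /IHs]; rewrite big_cons expnS; apply: leq_mul.
have lt_d : M - m.+1 < d by lia.
case: (boolP (prime m)) => [m_pr|m_npr]; last first.
  rewrite !(big_ltn_cond lt_mM) (negPf m_npr); apply: IHd => //.
  apply/allP => p p_s; rewrite ltn_neqAle (allP ge_m) // andbT.
  by apply: contraNneq m_npr => ->; apply: (allP prs).
rewrite !(big_ltn_cond lt_mM) m_pr.
case: s srt prs ge_m => [|p s] srt; first by rewrite add1n.
move=> /andP[_ prs] /andP[le_mp _] /=; rewrite add1n subSS ltnS => le_k.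
rewrite big_cons -mulnA; apply: leq_mul => //.
exact: IHd lt_d lt_mM (path_sorted srt) prs (sorted_all_gt _ _ _ le_mp srt) le_k.
Qed.

Lemma all_prime_primes n : all prime (primes n).
Proof. by apply/allP => p; rewrite mem_primes => /and3P[]. Qed.

Lemma all_ge2_primes n : all (leq 2) (primes n).
Proof. by apply/allP => p /(allP (all_prime_primes n))/prime_gt1. Qed.

Lemma prod_primes_gt0 n : 0 < \prod_(p <- primes n) p.
Proof.
rewrite big_seq prodn_cond_gt0 // => p /(allP (all_prime_primes n)); exact: prime_gt0.
Qed.

Lemma totient_prod_primes n : 0 < n ->
  totient n * \prod_(p <- primes n) p = n * \prod_(p <- primes n) p.-1.
Proof.
move=> n_gt0; rewrite totientE // [X in _ = X * _](prod_prime_decomp n_gt0) prime_decompE.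
rewrite big_map -!big_split big_seq [RHS]big_seq; apply: eq_bigr => p /=.
by rewrite -logn_gt0 => /prednK{2}<-; rewrite expnS; lia.
Qed.

Lemma prod_primes_leq n : 0 < n -> \prod_(p <- primes n) p <= n.
Proof.
move=> n_gt0; rewrite [leqRHS](prod_prime_decomp n_gt0) prime_decompE.
rewrite big_map big_seq [leqRHS]big_seq; apply: leq_prod => p /=.
rewrite -logn_gt0 => l_gt0; rewrite -{1}[p]expn1 leq_exp2l //.
by apply: prime_gt1; move: l_gt0; rewrite logn_gt0 => /(allP (all_prime_primes n)).
Qed.

Lemma primes_lt19 (R : Type) (idx : R) op F :
  \big[op/idx]_(2 <= q < 19 | prime q) F q =
  op (F 2) (op (F 3) (op (F 5) (op (F 7) (op (F 11) (op (F 13) (op (F 17) idx)))))).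
Proof. by rewrite -big_filter unlock. Qed.

(** With at most seven prime divisors the truncated subtraction gives 0, leaving the Euler product
    over the primes up to 17. *)
Lemma totient_ge n : 0 < n ->
  18 * (1 * 2 * 4 * 6 * 10 * 12 * 16) * n <=
  (18 + (size (primes n) - 7)) * (2 * 3 * 5 * 7 * 11 * 13 * 17) * totient n.
Proof.
move=> n_gt0.
have := prod_pred_ge_primes 2 19 _ isT (sorted_primes n) (all_prime_primes n) (all_ge2_primes n).
rewrite !primes_lt19 => /(leq_mul (leqnn n)) le_n.
rewrite -(leq_pmul2r (prod_primes_gt0 n)) -[leqRHS]mulnA totient_prod_primes //.
move: (\prod_(p <- _) p) (\prod_(p <- _) p.-1) (size _ - _) le_n => a b k.
lia.
Qed.

Lemma leq_primes19 n : 0 < n -> 7 <= size (primes n) ->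
  2 * 3 * 5 * 7 * 11 * 13 * 17 * 19 ^ (size (primes n) - 7) <= n.
Proof.
move=> n_gt0 k_ge7; apply: leq_trans (prod_primes_leq n n_gt0).
have := prod_ge_primes 2 19 _ isT (sorted_primes n) (all_prime_primes n) (all_ge2_primes n).
by rewrite !primes_lt19 muln1 !mulnA => /(_ k_ge7).
Qed.

(** * Cardinalities of [P_set] and [X_set] *)

Lemma card_P_set_lt N : 3 <= N -> #|P_set N| < prime_count N.*2.
Proof.
move=> N_ge3; have lt2 : 2 < N.*2 - 2 by lia.
apply: (@leq_trans #|[set x : 'I_(N.*2 - 2) | prime x]|).
  apply/proper_card/properP; split.
    by apply/subsetP => x; rewrite !inE => /andP[].
  by exists (Ordinal lt2); rewrite !inE //= dvdn2 odd_double.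
rewrite -sum1_card (eq_bigl (fun x : 'I__ => prime x)); last by move=> x; rewrite inE.
rewrite -(big_mkord prime (fun=> 1)) /prime_count.
rewrite [leqRHS](big_cat_nat (n := N.*2 - 2)) ?leq_addr //; lia.
Qed.

Lemma totient_le_card N : 3 <= N -> totient N.*2 <= #|P_set N| + #|X_set N| + 2.
Proof.
move=> N_ge3; set n := N.*2.
have [m nE] : exists m, n = m.+2 by exists (n - 2); rewrite /n; lia.
have odd_m : odd m = false.
  by rewrite -[odd m]negbK -[~~ ~~ _]/(odd m.+2) -nE odd_double.
(* As [n - 2] is even, [n - 1] is the only possible totative outside the range of the ordinals. *)
have ncop : coprime n m = false.
  apply/negbTE/negP => /eqP gcd1; have : 2 %| gcdn n m.
    by rewrite dvdn_gcd !dvdn2 odd_m odd_double.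
  by rewrite gcd1.
have -> : totient n = \sum_(0 <= d < m) coprime n d + coprime n m.+1.
  by rewrite totient_count_coprime {1}nE !big_nat_recr //= ncop addn0.
have mE : m = N.*2 - 2 by rewrite -/n nE; lia.
have lt1 : 1 < N.*2 - 2 by lia.
suff : \sum_(0 <= d < m) coprime n d <= (#|P_set N| + #|X_set N|).+1.
  by move=> /leq_add/(_ (leq_b1 (coprime n m.+1))); rewrite addn1 addn2.
rewrite mE big_mkord -big_mkcond sum1_card.
have le_card : #|Ordinal lt1 |: (P_set N :|: X_set N)| <= (#|P_set N| + #|X_set N|).+1.
  by rewrite cardsU1 (leq_add (leq_b1 _)) // cardsU leq_subr.
apply: leq_trans le_card; apply/subset_leq_card/subsetP => x.
rewrite unfold_in /= => cop; rewrite !inE.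
have ndvd p : prime p -> p %| x -> ~~ (p %| n).
  move=> p_pr p_x; apply: contraL p_pr => p_n.
  have : p %| gcdn n x by rewrite dvdn_gcd p_n.
  by rewrite (eqP cop) dvdn1 => /eqP->.
have [x_pr|x_npr] := boolP (prime x); first by rewrite ndvd ?orbT.
have x_gt0 : 0 < x.
  by rewrite lt0n; apply: contraTneq cop => ->; rewrite /coprime gcdn0 nE.
have [x1|x_neq1] := eqVneq x (Ordinal lt1); first by [].
have x_gt1 : 1 < x by rewrite ltn_neqAle x_gt0 andbT eq_sym; apply: x_neq1.
rewrite /composite x_npr x_gt1 /=.
apply/allP => p; rewrite mem_primes => /and3P[p_pr _ p_x].
by rewrite ndvd // andbT (leq_ltn_trans (dvdn_leq x_gt0 p_x)).
Qed.

Local Open Scope R_scope.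

(** * Comparing primes with totatives *)

Lemma prime_count_lt_totient n : (3 * 10 ^ 6 <= n)%N ->
  (2 * prime_count n < totient n)%N.
Proof.
move=> n_ge; have n_gt0 : (0 < n)%N by lia.
rewrite ltnNge; apply/negP => le_tot.
set j := (size (primes n) - 7)%N.
(* 1658880 = 18 (2 - 1) (3 - 1) ... (17 - 1) and 510510 = 2 * 3 * ... * 17. *)
have tot : 1658880 * INR n <= (18 + INR j) * 510510 * INR (totient n).
  rewrite !INR_IZR_INZ -!mult_IZR -plus_IZR -!mult_IZR; apply: IZR_le.
  by have := totient_ge n n_gt0; rewrite -/j; lia.
have := prime_count_bound n n_gt0.
set L := log2 (INR n).
have L_ge : 667 / 31 <= L.
  have le3 : IZR 3000000 <= INR n by rewrite INR_IZR_INZ; apply: IZR_le; lia.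
  have := @log2_geZ 3000000 31 667 ltac:(lia) ltac:(lia) ltac:(lia) ltac:(by vm_compute).
  by have := log2_le 3000000 (INR n) ltac:(lra) le3; rewrite -/L; lra.
(* 18.96 = 474/25 and 4.24 = 106/25 bound [log2 510510] and [log2 19] from below. *)
have Lj_ge : (0 < j)%N -> 18.96 + 4.24 * INR j <= L.
  move=> j_gt0; have /leP/le_INR := leq_primes19 n n_gt0 ltac:(lia).
  rewrite -/j mult_INR INR_expn => le_n.
  have Q : INR (2 * 3 * 5 * 7 * 11 * 13 * 17) = 510510.
    by rewrite INR_IZR_INZ; congr IZR; lia.
  have INR19 : INR 19 = 19 by rewrite INR_IZR_INZ.
  rewrite Q INR19 in le_n.
  have p19 : 0 < 19 ^ j by apply: pow_lt; lra.
  have := log2_le _ _ _ le_n; rewrite log2_mult ?log2_pow -/L; try lra.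
  have := @log2_geZ 510510 25 474 ltac:(lia) ltac:(lia) ltac:(lia) ltac:(by vm_compute).
  have := @log2_geZ 19 25 106 ltac:(lia) ltac:(lia) ltac:(lia) ltac:(by vm_compute).
  have := pos_INR j; nra.
have le_totR : INR (totient n) <= 2 * INR (prime_count n).
  by rewrite -[2]/(INR 2) -mult_INR; apply/le_INR/leP.
have n_gt0R : 0 < INR n by apply: lt_0_INR; lia.
have j_ge0 := pos_INR j.
move=> pi_le.
(* 1638737.1 = 510510 * 2 * 1.605. *)
have L_le : 1658880 * (L - 3.6) <= 1638737.1 * (18 + INR j).
  apply: (Rmult_le_reg_l (INR n)) => //.
  have := Rmult_le_compat_r (L - 3.6) _ _ ltac:(lra) tot.
  have := Rmult_le_compat_l (18 + INR j) _ _ ltac:(lra) pi_le.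
  have := Rmult_le_compat_r ((18 + INR j) * (L - 3.6)) _ _ ltac:(nra) le_totR.
  nra.
(* For [j = 0], [L_le] gives [L < 21.4], against [667 / 31 > 21.5]. For [j >= 1], [Lj_ge] already
   contradicts it at [j = 1], and its slope 4.24 exceeds the slope of [L_le], which is below 1. *)
case: (posnP j) => [j0|j_gt0].
  by move: L_le; rewrite j0 [INR 0]/=; lra.
have := le_INR 1 j (elimT leP j_gt0); have := Lj_ge j_gt0; rewrite [INR 1]/=; lra.
Qed.

Local Close Scope R_scope.

Theorem theorem2 (N : nat) (hN : 0 < N) (h : 3000000 <= N.*2) :
  #|P_set N| < #|X_set N|.
Proof.
rewrite three_millionE in h.
have N_ge3 : (3 <= N)%N by lia.
have := card_P_set_lt N N_ge3; have := totient_le_card N N_ge3.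
have := prime_count_lt_totient N.*2 h; lia.
Qed.
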